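(* Let $n>1$, $d\ge 2$ and $t$ be integers with $\gcd(t,d)=1$, $n\equiv t\pmod d$ and $n+d-nd\le t\le n$. Then, modulo $[n]_{q^2}\Phi_n(q^2)^2$, \[ \sum_{k=0}^{(n-t)/d}[2dk+t]_{q^2}[2dk+t]^2\frac{(q^{2t};q^{2d})_k^4}{(q^{2d};q^{2d})_k^4}q^{-4tk}\equiv \frac{-2[t]^2[n]_{q^2}(q^{4t};q^{2d})_{(n-t)/d}}{(1+q^{2t})(q^{2d};q^{2d})_{(n-t)/d}}q^{t-2t(n-t)/d}, \] and \[ \sum_{k=0}^{n-1}[2dk+t]_{q^2}[2dk+t]^2\frac{(q^{2t};q^{2d})_k^4}{(q^{2d};q^{2d})_k^4}q^{-4tk}\equiv \frac{-2[t]^2[n]_{q^2}(q^{4t};q^{2d})_{(n-t)/d}}{(1+q^{2t})(q^{2d};q^{2d})_{(n-t)/d}}q^{t-2t(n-t)/d}. \]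
   Context: For an indeterminate $q$, $(x;q)_k=(1-x)(1-xq)\cdots(1-xq^{k-1})$ (with $(x;q)_0=1$). For any integer $m$, $[m]=(1-q^m)/(1-q)$ and $[m]_{q^2}=(1-q^{2m})/(1-q^2)$. $\Phi_n(x)$ is the $n$-th cyclotomic polynomial, evaluated here at $x=q^2$. A congruence $A\equiv B\pmod{P(q)}$ between rational functions in $q$ means that $A-B$, written as a quotient of polynomials with denominator coprime to $P(q)$, has numerator divisible by $P(q)$. *)

(* Defs.v *)
From HB Require Import structures.
From mathcomp Require Import all_boot all_order all_algebra all_field.
From mathcomp Require Import fraction.
Set Implicit Arguments. Unset Strict Implicit. Unset Printing Implicit Defensive.
Import Order.TTheory GRing.Theory Num.Theory.
Local Open Scope ring_scope.

Notation RF := {fraction {poly rat}}.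
Notation "x %:F" := (@FracField.tofrac _ x).


Definition qq : RF := ('X : {poly rat})%:F.

Definition qpoch (x p : RF) (k : nat) : RF := \prod_(i < k) (1 - x * p ^+ i).

Definition qint (m : int) : RF := (1 - qq ^ m) / (1 - qq).

Definition qint2 (m : int) : RF := (1 - qq ^ (2 * m)) / (1 - qq ^+ 2).

Definition PhiQ2 (n : nat) : {poly rat} :=
  map_poly (intr : int -> rat) ('Phi_n) \Po ('X ^+ 2).

Definition qint2_poly (n : nat) : {poly rat} := \sum_(i < n) 'X ^+ (2 * i).

Definition cong_mod (A B : RF) (P : {poly rat}) : Prop :=
  exists N D : {poly rat},
    [/\ D != 0, coprimep D P, P %| N & A - B = N%:F / D%:F].

(* Main.v *)
Require Import Defs.
From HB Require Import structures.
From mathcomp Require Import all_boot all_order all_algebra all_field.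
From mathcomp Require Import fraction ring zify.
Set Implicit Arguments. Unset Strict Implicit. Unset Printing Implicit Defensive.
Import Order.TTheory GRing.Theory Num.Theory.
Local Open Scope ring_scope.

(**
Put h = q^t, a = h^2, p = q^(2d), eps = q^(2n) = a p^m, and psi u = (1 - u)^2 / u,
chi u = (1 - u^2)(1 - u)^2 / u^2. Up to the factor a / ((1 - q^2)(1 - q)^2), the k-th summand is
chi (h p^k) D_k^2 with D_k = prod_(i < k) psi (a p^i) / psi (p^(i+1)).

The congruence is checked at every complex root z of the modulus. If z^2 has order e, then a
reduces to p^(-m), the products D_k reduce to ones with D_(m' - k) = D_k for m' = m mod e, and chi
changes sign under u -> 1/u; so the terms of each block of e consecutive indices cancel in pairs,
which gives order 1.

If e = n, order 3 is needed. Replace D_k^2 by D_k D_k(w), where D_k(w) has psi - w in place of psi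
and w = psi eps vanishes to order 2 at z. To first order in w this changes the sum by w times the
same sum weighted by sums of 1/psi that are again invariant under k -> m - k, so by the cancellation
above the error has order 3. As psi u - psi eps = (1 - u eps)(1 - u / eps) / u, the new sum is a
terminating very-well-poised series; it is a combination of two terminating 6W5 sums and has a
closed form, which differs from the right-hand side by a multiple of (1 - eps) w.
*)

(** * Terminating very-well-poised sums *)

Section WellPoised.
Variable L : fieldType.
Implicit Types a d e p h u w : L.

(* The parameter [p ^- m] of the terminating series appears as [p ^+ m - p ^+ i]; the factor
   [p ^+ m] is absorbed into the argument. *)
Definition wp_weight a d e p (m k : nat) : L :=
  \prod_(i < k) ((1 - a * p ^+ i) * (1 - d * p ^+ i) * (1 - e * p ^+ i)
     * (p ^+ m - p ^+ i)
     / ((1 - p ^+ i.+1) * (1 - a * p ^+ i.+1 / d) * (1 - a * p ^+ i.+1 / e)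
        * (1 - a * p ^+ (m + i.+1))) * (a * p / (d * e))).

Lemma wp_weightS a d e p m k : wp_weight a d e p m k.+1 =
  wp_weight a d e p m k * ((1 - a * p ^+ k) * (1 - d * p ^+ k) * (1 - e * p ^+ k)
     * (p ^+ m - p ^+ k)
     / ((1 - p ^+ k.+1) * (1 - a * p ^+ k.+1 / d) * (1 - a * p ^+ k.+1 / e)
        * (1 - a * p ^+ (m + k.+1))) * (a * p / (d * e))).
Proof. by rewrite /wp_weight big_ord_recr. Qed.

(** Passing from [m] to [m.+1] multiplies the weight by a rational function of [p ^+ k], so both
    sides of the recurrence in [m] can be compared over one common weight. *)
Lemma wp_weight_raise a d e p m k : p != 0 ->
    (forall i, 1 - p ^+ i.+1 != 0) -> (forall i, 1 - a * p ^+ i.+1 != 0) ->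
  wp_weight a d e p m k = wp_weight a d e p m.+1 k *
   ((p * p ^+ m - p ^+ k) * (1 - a * p ^+ (m + k.+1))
     / (p ^+ k * (p * p ^+ m - 1) * (1 - a * (p * p ^+ m)))).
Proof.
move=> p0 hp ha.
have hM : p * p ^+ m - 1 != 0 by rewrite -oppr_eq0 opprB -exprS.
elim: k => [|k IH].
  rewrite /wp_weight !big_ord0 expr0 addn1 -exprS.
  have := ha m; rewrite exprS => haM; field; exact/andP.
rewrite !wp_weightS IH.
have h1 := ha (m + k)%N; have h2 := ha (m + k).+1.
rewrite !addnS addSn in h1 h2 *.
have hK : p ^+ k != 0 by rewrite expf_neq0.
have := ha m; move: h1 h2; rewrite !exprS exprD => h1 h2 h3.
rewrite !invfM; set x := (1 - p * p ^+ k)^-1; set y := (1 - a * (p * p ^+ k) / d)^-1.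
set z := (1 - a * (p * p ^+ k) / e)^-1; set d' := d^-1; set e' := e^-1.
by field; rewrite ?p0 ?h1 ?h2 ?h3 ?hK ?hM.
Qed.

(** Rogers' terminating very-well-poised 6phi5 summation, with the usual denominator [1 - a] moved
    to the right. Induction on [m]: the sum satisfies a first-order recurrence, proved by
    telescoping. *)
Lemma sum_6W5 a d e p m : p != 0 -> a != 0 -> d != 0 -> e != 0 ->
    (forall i, 1 - p ^+ i.+1 != 0) -> (forall i, 1 - a * p ^+ i.+1 != 0) ->
    (forall i, 1 - a * p ^+ i.+1 / d != 0) ->
    (forall i, 1 - a * p ^+ i.+1 / e != 0) ->
  \sum_(0 <= k < m.+1) (1 - a * p ^+ (2 * k)) * wp_weight a d e p m k =
  (1 - a) * \prod_(i < m) ((1 - a * p ^+ i.+1) * (1 - a * p ^+ i.+1 / (d * e))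
       / ((1 - a * p ^+ i.+1 / d) * (1 - a * p ^+ i.+1 / e))).
Proof.
move=> p0 a0 d0 e0 hp ha hd he; elim: m => [|m IH].
  by rewrite big_nat1 /wp_weight !big_ord0 expr0 !mulr1.
rewrite big_ord_recr /= mulrA -IH.
set rho := (X in _ = _ * X).
set M := p ^+ m.
(* [G] is the WZ certificate of the recurrence in [m]. *)
pose G k : L := p * M * (1 - p ^+ k) * (1 - a * p ^+ k / d) * (1 - a * p ^+ k / e)
   * (1 - a * p * M * p ^+ k)
   / ((1 - a * p * M / d) * (1 - a * p * M / e) * p ^+ k * (p * M - 1))
   * wp_weight a d e p m.+1 k.
have hM : p * M - 1 != 0 by rewrite -oppr_eq0 opprB -exprS.
(* Once the common weight is factored out, this is a rational identity in [p ^+ k] and [M]. *)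
have step k : (1 - a * p ^+ (2 * k)) * wp_weight a d e p m.+1 k =
    rho * ((1 - a * p ^+ (2 * k)) * wp_weight a d e p m k) + (G k.+1 - G k).
  rewrite [wp_weight a d e p m k]wp_weight_raise // /G wp_weightS /rho.
  have h1 := ha (m + k)%N; have h2 := ha (m + k).+1; have h3 := ha m.
  have h4 := hd m; have h5 := he m; have h6 := hp k; have h7 := hd k; have h8 := he k.
  have hK : p ^+ k != 0 by rewrite expf_neq0.
  move: h1 h2 h3 h4 h5 h6 h7 h8; rewrite !addnS addSn mul2n -addnn !exprS !exprD -/M.
  move: (wp_weight _ _ _ _ _ _) (p ^+ k) hK => W K hK.
  clear IH G rho; move: M hM => M hM h1 h2 h3 h4 h5 h6 h7 h8.
  have eqd x : 1 - x / d = (d - x) / d by field.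
  have eqe x : 1 - x / e = (e - x) / e by field.
  have nzd x : 1 - x / d != 0 -> d - x != 0 by rewrite eqd mulf_eq0 negb_or => /andP[].
  have nze x : 1 - x / e != 0 -> e - x != 0 by rewrite eqe mulf_eq0 negb_or => /andP[].
  move/nzd: h4 => h4; move/nze: h5 => h5; move/nzd: h7 => h7; move/nze: h8 => h8.
  field.
  by rewrite ?p0 ?a0 ?d0 ?e0 ?hK ?hM /= -?mulrA ?h1 ?h2 ?h3 ?h4 ?h5 ?h6 ?h7 ?h8.
under eq_bigr do rewrite step.
rewrite big_split /= -mulr_sumr telescope_sumr //.
(* The weight for [m.+1] terminates: its factor of index [m.+1] is zero. For the same reason the
   weight for [m] contributes nothing at [k = m.+1] below. *)
have -> : G m.+2 = 0 by rewrite /G wp_weightS subrr !(mulr0, mul0r).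
have -> : G 0%N = 0 by rewrite /G expr0 subrr !(mulr0, mul0r).
rewrite subrr addr0 big_nat_recr //= wp_weightS subrr !(mulr0, mul0r) addr0.
by rewrite mulrC.
Qed.
End WellPoised.

(** * Sums of chi over products of psi *)

Section PsiSums.
Variable L : fieldType.
Implicit Types a d e p h u w : L.

(** For nonzero [u], [psi u] is u + 1/u - 2 and [chi u] is (1/u - u) times [psi u]; this makes the
    first even and the second odd under inversion. *)
Definition psi u := (1 - u) ^+ 2 / u.
Definition chi u := (1 - u ^+ 2) * (1 - u) ^+ 2 / u ^+ 2.
Definition psi_prod a p w k : L :=
  \prod_(i < k) ((psi (a * p ^+ i) - w) / (psi (p ^+ i.+1) - w)).

Lemma psi_prodS a p w k : psi_prod a p w k.+1 =
  psi_prod a p w k * ((psi (a * p ^+ k) - w) / (psi (p ^+ k.+1) - w)).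
Proof. by rewrite /psi_prod big_ord_recr. Qed.

Lemma psi_prodD a p k s : psi_prod a p 0 (k + s) = psi_prod a p 0 k *
  \prod_(i < s) (psi (a * p ^+ (k + i)) / psi (p ^+ (k + i).+1)).
Proof.
rewrite /psi_prod big_split_ord /=; congr (_ * _).
by apply: eq_bigr => i _; rewrite !subr0.
Qed.

Lemma psiV u : psi u^-1 = psi u.
Proof.
have [->|u0] := eqVneq u 0; first by rewrite invr0.
by rewrite /psi; field; rewrite u0 oner_neq0.
Qed.

Lemma psi_neq0 u : u != 0 -> 1 - u != 0 -> psi u != 0.
Proof. by move=> u0 u1; rewrite mulf_neq0 ?invr_eq0 // expf_neq0. Qed.

Lemma psiB u v : u != 0 -> v != 0 -> psi u - psi v = (1 - u * v) * (1 - u / v) / u.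
Proof. by move=> u0 v0; rewrite /psi; field; apply/andP. Qed.

Lemma chiV u : chi u^-1 = - chi u.
Proof.
have [->|u0] := eqVneq u 0; first by rewrite /chi invr0 !(expr0n, mulr0, mul0r, invr0, oppr0).
by rewrite /chi; field; rewrite ?u0 ?oner_neq0.
Qed.

(** The two arguments are inverse to each other. The exponent is written as a successor to match the
    denominators of [psi_prod]. *)
Lemma psi_reflect a p m k : p != 0 -> a * p ^+ m = 1 -> (k < m)%N ->
  psi (a * p ^+ k) = psi (p ^+ (m - k.+1).+1).
Proof.
move=> p0 apm km; rewrite -psiV; congr psi.
have a0 : a != 0 by apply/eqP => a0; move/eqP: apm; rewrite a0 mul0r eq_sym oner_eq0.
have apk0 : a * p ^+ k != 0 by rewrite mulf_neq0 ?expf_neq0.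
by apply: (mulIf apk0); rewrite mulVf // mulrCA -exprD addSnnS subnK.
Qed.

(** When [a] is the inverse of [p ^+ m], the product is a binomial coefficient m over k whose
    factorials are built from the [psi (p ^+ i)]. The symmetry under k -> m - k can be read off. *)
Lemma psi_prod0E a p m k : p != 0 -> a * p ^+ m = 1 -> (k <= m)%N ->
    (forall i, (0 < i <= m)%N -> 1 - p ^+ i != 0) ->
  psi_prod a p 0 k * ((\prod_(i < m - k) psi (p ^+ i.+1)) * (\prod_(i < k) psi (p ^+ i.+1)))
   = \prod_(i < m) psi (p ^+ i.+1).
Proof.
move=> p0 apm; elim: k => [|k IH] km hp.
  by rewrite /psi_prod !big_ord0 mul1r mulr1 subn0.
rewrite -IH ?(ltnW km) // psi_prodS !subr0 (big_ord_recr k) /=.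
have -> : (m - k = (m - k.+1).+1)%N by lia.
rewrite big_ord_recr /=.
rewrite (psi_reflect p0 apm km).
have : psi (p ^+ k.+1) != 0.
  by apply: psi_neq0; rewrite ?expf_neq0 //; apply: hp.
by move: (psi (p ^+ k.+1)) => x x0; field.
Qed.

Lemma psi_prod_sym a p m k : p != 0 -> a * p ^+ m = 1 -> (k <= m)%N ->
    (forall i, (0 < i <= m)%N -> 1 - p ^+ i != 0) ->
  psi_prod a p 0 (m - k) = psi_prod a p 0 k.
Proof.
move=> p0 apm km hp.
have := psi_prod0E p0 apm (leq_subr k m) hp.
rewrite -(psi_prod0E p0 apm km hp) subKn // [X in _ * X]mulrC.
apply: mulIf; rewrite mulf_neq0 //; apply/prodf_neq0 => i _;
  apply: psi_neq0; rewrite ?expf_neq0 //; apply: hp; have := ltn_ord i; lia.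
Qed.

(** Reversing the order of summation inverts [h * p ^+ k] and hence flips the sign of [chi], so the
    sum is its own opposite. The symmetric weight [K] is 1 for first-order vanishing and [psi_harm]
    for the perturbation. *)
Lemma chi_sum_antisym h p m (K : nat -> L) : 2%:R != 0 :> L ->
    p != 0 -> h ^+ 2 * p ^+ m = 1 ->
    (forall i, (0 < i <= m)%N -> 1 - p ^+ i != 0) ->
    (forall k, (k <= m)%N -> K (m - k)%N = K k) ->
  \sum_(0 <= k < m.+1) chi (h * p ^+ k) * psi_prod (h ^+ 2) p 0 k ^+ 2 * K k = 0.
Proof.
move=> L2 p0 hpm hp hK; set S := LHS.
have : S = - S.
  rewrite {1}/S big_nat_rev /= /S -sumrN; apply: eq_big_nat => k /andP[_ km].
  rewrite add0n subSS psi_prod_sym // hK // -[RHS]mulNr -[X in _ = X * _]mulNr; congr (_ * _ * _).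
  rewrite -chiV; congr chi.
  have e : p ^+ m = p ^+ (m - k) * p ^+ k by rewrite -exprD subnK.
  have h0 : h != 0.
    by apply/eqP => h0; move/eqP: hpm; rewrite h0 expr0n mul0r eq_sym oner_eq0.
  have pk0 : p ^+ k != 0 by rewrite expf_neq0.
  apply: (mulIf (mulf_neq0 h0 pk0)); rewrite mulVf ?mulf_neq0 //.
  by rewrite -hpm e; ring.
move/eqP; rewrite -addr_eq0 -mulr2n -mulr_natr mulf_eq0 (negPf L2) orbF.
by move/eqP.
Qed.

(** The logarithmic derivative of [psi_prod a p w k] in [w] at [w = 0]. *)
Definition psi_harm a p k : L :=
  \sum_(i < k) ((psi (p ^+ i.+1))^-1 - (psi (a * p ^+ i))^-1).

Lemma psi_harm_sym a p m k : p != 0 -> a * p ^+ m = 1 -> (k <= m)%N ->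
  psi_harm a p (m - k) = psi_harm a p k.
Proof.
move=> p0 apm.
(* By reflection, the terms with [a] are the last [j] terms of the full harmonic sum. Adding that
   full sum leaves an expression symmetric in [j] and [m - j]. *)
have E j : (j <= m)%N -> psi_harm a p j + \sum_(i < m) (psi (p ^+ i.+1))^-1
   = \sum_(i < j) (psi (p ^+ i.+1))^-1 + \sum_(i < m - j) (psi (p ^+ i.+1))^-1.
  elim: j => [|j IH] jm; first by rewrite /psi_harm !big_ord0 !add0r subn0.
  rewrite /psi_harm big_ord_recr /= -/(psi_harm a p j) addrAC IH ?(ltnW jm) //.
  have -> : (m - j = (m - j.+1).+1)%N by lia.
  rewrite !big_ord_recr /=.
  rewrite (psi_reflect p0 apm jm); ring.
move=> km; apply: (addIr (\sum_(i < m) (psi (p ^+ i.+1))^-1)).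
by rewrite !E ?leq_subr // subKn // addrC.
Qed.

(** Replacing [d] by [d * p] shifts two Pochhammer symbols by one step, so only their end factors
    change; the power of [p] comes from the argument of the series. *)
Lemma wp_weight_shift a d e p m k : p != 0 -> d != 0 -> 1 - a / d != 0 ->
    (forall i, 1 - a * p ^+ i.+1 / d != 0) ->
  wp_weight a d e p m k * ((1 - d * p ^+ k) * (1 - a * p ^+ k / d)) / p ^+ k =
  (1 - d) * (1 - a / d) * wp_weight a (d * p) e p m k.
Proof.
move=> p0 d0 ad hd; elim: k => [|k IH].
  by rewrite /wp_weight !big_ord0 expr0; field; rewrite d0 oner_neq0.
have hK : p ^+ k != 0 by rewrite expf_neq0.
have hk : 1 - a * p ^+ k / d != 0 by case: (k) => [|?]; rewrite ?expr0 ?mulr1.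
rewrite !wp_weightS [RHS]mulrA -IH; have := hd k.
have eqd x : 1 - x / d = (d - x) / d by field.
have nzd x : 1 - x / d != 0 -> d - x != 0 by rewrite eqd mulf_eq0 negb_or => /andP[].
move=> /nzd; move/nzd: hk.
rewrite !invfM !exprS.
have -> : a * (p * p ^+ k) * (d^-1 * p^-1) = a * p ^+ k / d by field; apply/andP.
set z := (1 - a * (p * p ^+ k) / e)^-1; set e' := e^-1.
set y := (1 - a * p ^+ _)^-1; set x := (1 - p * p ^+ k)^-1.
by move=> h1 h2; field; rewrite ?p0 ?d0 ?hK ?h1 ?h2.
Qed.

(** With [K = p ^+ k] and [eps / a = p ^+ m], the right side is one factor of
    [wp_weight a (a * eps) a p m]. *)
Lemma psi_ratio a p eps K : p != 0 -> a != 0 -> eps != 0 -> K != 0 ->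
    1 - p * K != 0 -> 1 - p * K / eps != 0 -> 1 - eps * (p * K) != 0 ->
  psi (a * K) / psi (p * K) * ((psi (a * K) - psi eps) / (psi (p * K) - psi eps)) / p =
  (1 - a * K) * (1 - a * eps * K) * (1 - a * K) * (eps / a - K)
     / ((1 - p * K) * (1 - a * (p * K) / (a * eps)) * (1 - a * (p * K) / a)
        * (1 - eps * (p * K))) * (a * p / (a * eps * a)).
Proof.
move=> p0 a0 e0 K0 h1 h2 h3.
have h2' : eps - p * K != 0.
  by apply: contraNneq h2 => /eqP; rewrite subr_eq0 => /eqP <-; rewrite divff // subrr.
rewrite !psiB ?mulf_neq0 // /psi.
rewrite [a * (p * K) / (a * eps)](_ : _ = p * K / eps); last by field; rewrite a0 e0.
rewrite [a * (p * K) / a](_ : _ = p * K); last by field.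
rewrite [p * K * eps]mulrC.
move: (1 - eps * (p * K)) h3 => X X0.
by field; rewrite ?p0 ?a0 ?e0 ?K0 ?h1 ?h2' ?X0.
Qed.

(** The sum is a combination of two instances of [sum_6W5], with parameters [a * eps] and
    [a * eps * p]. The result is split so that one part carries the factor [(1 - eps) * psi eps] and
    the other is the wanted closed form up to sign. *)
Lemma perturbed_chi_sum h p m : let a := h ^+ 2 in let eps := a * p ^+ m in
    p != 0 -> h != 0 ->
    (forall i, 1 - p ^+ i.+1 != 0) -> (forall i, 1 - a * p ^+ i != 0) ->
    (forall i, 1 - p ^+ i / eps != 0) -> 1 + a != 0 ->
  a * \sum_(0 <= k < m.+1)
     chi (h * p ^+ k) * (psi_prod a p 0 k * psi_prod a p (psi eps) k) =
  (1 - eps) * (\prod_(i < m) ((1 - a ^+ 2 * p ^+ i) / (1 - p ^+ i.+1))) / a ^+ m *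
    (a * psi eps / (1 + a) - 2 * h * (1 - h) ^+ 2 / (1 + a)).
Proof.
move=> a eps p0 h0 hp ha he a1.
have a0 : a != 0 by rewrite expf_neq0.
have e0 : eps != 0 by rewrite mulf_neq0 ?expf_neq0.
pose d := a * eps.
have d0 : d != 0 by rewrite mulf_neq0.
have adE x : a * x / d = x / eps by rewrite /d; field; apply/andP.
have hpk k : p ^+ k != 0 by rewrite expf_neq0.
have D k : psi_prod a p 0 k * psi_prod a p (psi eps) k / p ^+ k = wp_weight a d a p m k.
  elim: k => [|k IH]; first by rewrite /psi_prod /wp_weight !big_ord0 expr0 invr1 !mulr1.
  have h1 := hp k; have h2 := he k.+1; have h3 := ha (m + k.+1)%N.
  move: h3; rewrite wp_weightS -IH !psi_prodS !subr0 exprD mulrA -/eps /d.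
  rewrite (_ : p ^+ m = eps / a) => [h3|]; last by rewrite /eps; field.
  rewrite !exprS in h1 h2 h3 *; rewrite -psi_ratio //.
  have := hpk k; move: (psi_prod _ _ _ _) (psi_prod _ _ _ _) => X Y.
  move: (psi (a * p ^+ k) / psi (p * p ^+ k)) ((psi (a * p ^+ k) - _) / _) => Z T K0.
  by field; rewrite p0 K0.
have had : forall i, 1 - a * p ^+ i.+1 / d != 0 by move=> i; rewrite adE.
have had0 : 1 - a / d != 0 by have := he 0%N; rewrite expr0 -adE mulr1.
(* With K for [p ^+ k]: (1 - hK)^2/K and (1 - dK)(1 - aK/d)/K differ by the constant d + a/d - 2h,
   and the latter is absorbed by the shift of [d]. *)
have term k : a * (chi (h * p ^+ k) * (psi_prod a p 0 k * psi_prod a p (psi eps) k)) =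
    (1 - d) * (1 - a / d) * ((1 - a * p ^+ (2 * k)) * wp_weight a (d * p) a p m k)
    + (d + a / d - 2 * h) * ((1 - a * p ^+ (2 * k)) * wp_weight a d a p m k).
  rewrite [in X in X + _]mulrCA -(@wp_weight_shift a d a p m k) // -D /chi.
  rewrite mul2n -addnn exprD; have := hpk k; move: (p ^+ k) => K K0.
  move: (psi_prod _ _ _ _) (psi_prod _ _ _ _) => X Y.
  by rewrite /a; field; rewrite h0 K0 d0.
rewrite mulr_sumr; under eq_bigr do rewrite term.
rewrite big_split /= -!mulr_sumr.
have dpE x : a * x / (d * p) = x / p / eps by rewrite /d; field; rewrite p0 a0 e0.
have aE x : a * x / a = x by field.
have dp0 : d * p != 0 by rewrite mulf_neq0.
rewrite !sum_6W5 //; first last.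
- by move=> i; rewrite aE.
- by move=> i; rewrite dpE exprSr mulfK.
- by move=> i; rewrite aE.
pose f i := 1 - p ^+ i / (a * eps); pose g i := 1 - p ^+ i / eps.
pose A := \prod_(i < m) (1 - a * p ^+ i); pose B := \prod_(i < m) (1 - p ^+ i.+1).
have a1' : 1 - a != 0 by have := ha 0%N; rewrite expr0 mulr1.
have e1 : 1 - eps != 0 by rewrite ha.
(* The two evaluated products differ by an index shift in [f] and [g], hence only by end factors. *)
have shift (F : nat -> L) : F 0%N * \prod_(i < m) F i.+1 = \prod_(i < m) F i * F m.
  by rewrite -[RHS](big_ord_recr m (fun i => F (val i))) big_ord_recl.
have pE i : (i < m)%N -> p ^+ (m - i.+1).+1 = eps / (a * p ^+ i).
  move=> im; have -> : eps = a * (p ^+ (m - i.+1).+1 * p ^+ i).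
    by rewrite /eps -exprD addSnnS subnK.
  by have := hpk i; move: (p ^+ i) => x x0; field; rewrite a0 x0.
have A0 : A != 0 by apply/prodf_neq0.
have am := expf_neq0 m a0.
have B0 : B != 0 by apply/prodf_neq0.
(* Reversing the product turns p^(i+1) into eps/(a p^i), so [f] yields the factors of (a^2; p)_m and
   [g] those of (a; p)_m, up to powers of [a] and [p] and signs. *)
have fS : \prod_(i < m) f i.+1 =
    \prod_(i < m) (1 - a ^+ 2 * p ^+ i) / A / a ^+ m * \prod_(i < m) g i.+1.
  apply: (mulIf A0); apply: (mulIf am).
  rewrite [RHS](_ : _ = \prod_(i < m) (1 - a ^+ 2 * p ^+ i) * \prod_(i < m) g i.+1);
    last by field; rewrite A0 am.
  have -> : a ^+ m = \prod_(i < m) a by rewrite prodr_const card_ord.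
  rewrite (reindex_inj rev_ord_inj (P := xpredT)
    (F := fun i : 'I_m => f i.+1)) (reindex_inj rev_ord_inj (P := xpredT)
    (F := fun i : 'I_m => g i.+1)) -!big_split /=.
  apply: eq_bigr => i _; rewrite /f /g pE //.
  by have := hpk i; move: (p ^+ i) => x x0; field; rewrite a0 x0 e0.
have gS0 : \prod_(i < m) g i.+1 != 0 by apply/prodf_neq0 => i _; apply: he.
have AS : \prod_(i < m) (1 - a * p ^+ i.+1) = A * (1 - eps) / (1 - a).
  have := shift (fun i => 1 - a * p ^+ i); rewrite expr0 mulr1 -/A -/eps => <-.
  by rewrite mulrAC mulfV // mul1r.
have W1 : \prod_(i < m) ((1 - a * p ^+ i.+1) * (1 - a * p ^+ i.+1 / (d * a))
          / ((1 - a * p ^+ i.+1 / d) * (1 - a * p ^+ i.+1 / a))) =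
    \prod_(i < m) (1 - a * p ^+ i.+1) * \prod_(i < m) f i.+1
       / (\prod_(i < m) g i.+1 * B).
  rewrite -!big_split -prodf_div; apply: eq_bigr => i _ /=.
  rewrite adE aE /f /g.
  rewrite [X in _ * (1 - X) / _](_ : _ = p ^+ i.+1 / (a * eps)) // /d.
  by field; rewrite a0 e0.
have E1 : \prod_(i < m) ((1 - a * p ^+ i.+1) * (1 - a * p ^+ i.+1 / (d * a))
          / ((1 - a * p ^+ i.+1 / d) * (1 - a * p ^+ i.+1 / a))) =
   (1 - eps) / (1 - a) * (\prod_(i < m) (1 - a ^+ 2 * p ^+ i) / B) / a ^+ m.
  rewrite W1 AS fS; move: (\prod_(i < m) g i.+1) gS0 => X X0.
  by field; rewrite a1' A0 am B0 X0.
have E2 : \prod_(i < m) ((1 - a * p ^+ i.+1) * (1 - a * p ^+ i.+1 / (d * p * a))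
          / ((1 - a * p ^+ i.+1 / (d * p)) * (1 - a * p ^+ i.+1 / a))) =
   (1 - a^-1) * (1 - (a * eps)^-1) / ((1 - (a ^+ 2)^-1) * (1 - eps^-1)) *
   \prod_(i < m) ((1 - a * p ^+ i.+1) * (1 - a * p ^+ i.+1 / (d * a))
          / ((1 - a * p ^+ i.+1 / d) * (1 - a * p ^+ i.+1 / a))).
  have fm : f m = 1 - (a ^+ 2)^-1.
    rewrite /f /eps; have := hpk m; move: (p ^+ m) => x x0.
    by field; rewrite a0 x0.
  have gm : g m = 1 - a^-1.
    rewrite /g /eps; have := hpk m; move: (p ^+ m) => x x0.
    by field; rewrite a0 x0.
  have fm0 : f m != 0.
    rewrite fm (_ : _ - _ = - (1 - a) * (1 + a) / a ^+ 2); last by field.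
    by rewrite mulf_neq0 ?invr_eq0 // mulf_neq0 ?oppr_eq0.
  have gm0 : g m != 0 by apply: he.
  have g00 : g 0%N != 0 by apply: he.
  have fF := shift f; have gG := shift g.
  rewrite [LHS](_ : _ = \prod_(i < m) (1 - a * p ^+ i.+1) * \prod_(i < m) f i
       / (\prod_(i < m) g i * B)); last first.
    rewrite -!big_split -prodf_div; apply: eq_bigr => i _ /=.
    rewrite dpE aE exprSr mulfK // /f /g.
    by rewrite [X in _ * (1 - X) / _](_ : _ = p ^+ i / (a * eps)) // /d; field;
      rewrite a0 e0 p0.
  rewrite W1 -fm -gm.
  have -> : 1 - (a * eps)^-1 = f 0%N by rewrite /f expr0 div1r.
  have -> : 1 - eps^-1 = g 0%N by rewrite /g expr0 div1r.
  have -> : \prod_(i < m) f i = f 0%N * \prod_(i < m) f i.+1 / f m by rewrite fF mulfK.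
  have -> : \prod_(i < m) g i = g 0%N * \prod_(i < m) g i.+1 / g m by rewrite gG mulfK.
  move: gS0 fm0 gm0 g00 B0; move: (\prod_(i < m) g i.+1) (f m) (g m) (g 0%N) (B) => z1 z2 z3 z4 z5.
  by move=> n1 n2 n3 n4 n5; field; rewrite n1 n2 n3 n4 n5.
rewrite E2 E1 prodf_div -/B.
set P := \prod_(i < m) _.
have -> : 1 - a^-1 = - (1 - a) / a by field.
have -> : 1 - (a ^+ 2)^-1 = - (1 - a) * (1 + a) / a ^+ 2 by field.
have -> : 1 - eps^-1 = - (1 - eps) / eps by field.
rewrite /d /psi; move: (a ^+ m) am (a0) (a1) (a1') => am am0; rewrite /a => _ b1 b2.
move: (eps) e0 e1 => E E0 E1'.
by field; rewrite !oppr_eq0 b1 b2 E0 E1' h0 am0 B0.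
Qed.

Lemma psi_div u v : psi u / psi v = ((1 - u) / (1 - v)) ^+ 2 * (v / u).
Proof. by rewrite /psi expr_div_n invfM invrK mulrACA [u^-1 * v]mulrC. Qed.

(** Each quotient of [psi] values is a square times [p / a]; this is how the fourth powers of
    Pochhammer quotients in the summand become squares of [psi_prod]. *)
Lemma psi_prod0_sqr a p k : p != 0 -> a != 0 -> psi_prod a p 0 k =
  ((\prod_(i < k) (1 - a * p ^+ i)) / \prod_(i < k) (1 - p * p ^+ i)) ^+ 2 * (p / a) ^+ k.
Proof.
move=> p0 a0.
have -> : (p / a) ^+ k = \prod_(i < k) (p / a) by rewrite prodr_const card_ord.
rewrite -prodf_div -prodrXl -big_split.
apply: eq_bigr => i _ /=; rewrite !subr0 psi_div [p ^+ i.+1]exprS; congr (_ * _).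
by rewrite invfM mulrACA divff ?mulr1 // expf_neq0.
Qed.

(** The first-order Taylor expansion in [w] with its exact remainder, whose denominators are units
    at [z] in the application. *)
Lemma psi_prod_perturb_step x y w : x != 0 -> y != 0 -> y - w != 0 ->
  (x - w) / (y - w) = x / y * (1 + w * (y^-1 - x^-1) + w ^+ 2 * ((y^-1 - x^-1) / (y - w))).
Proof. by move=> x0 y0 yw0; field; rewrite x0 y0 yw0. Qed.

Lemma psi_prod_perturb_comb X Y H G eta gam w x y r : r = y * (1 + w * eta + w ^+ 2 * gam) ->
  X - Y * (1 + w * H) = w ^+ 2 * G -> x = r ->
  X * x - Y * y * (1 + w * (H + eta)) =
  w ^+ 2 * (G * r + Y * y * (H * eta + gam * (1 + w * H))).
Proof.
move=> rE /eqP; rewrite subr_eq => /eqP -> ->; rewrite rE; ring.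
Qed.
End PsiSums.

(** * The local ring of rational functions at an algebraic number *)

Notation Cpoly P := (map_poly (ratr : rat -> algC) P).

Section LocalRing.
Variable z : algC.
Implicit Types (N D : {poly rat}) (f g : RF) (v w : algC).

Notation evp N := (Cpoly N).[z].

(** The fraction [f] lies in the local ring at [z] and has residue [v]. A relation allows any
    representing fraction whose denominator does not vanish at [z]. *)
Definition ev f v := exists N D,
  [/\ evp D != 0, f = N%:F / D%:F & v = evp N / evp D].

(** Valuation at least [k] at [z]. Divisibility is tested over [algC], because [z] need not be
    rational. *)
Definition vanish (k : nat) f := exists N D,
  [/\ evp D != 0, ('X - z%:P) ^+ k %| Cpoly N & f = N%:F / D%:F].

Lemma tofrac_neq0 D : evp D != 0 -> D%:F != 0.
Proof.
by rewrite tofrac_eq0; apply: contraNneq => ->; rewrite rmorph0 horner0.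
Qed.

Lemma ev_tofrac N : ev N%:F (evp N).
Proof.
by exists N, 1; rewrite rmorph1 hornerC oner_neq0 tofrac1 !divr1.
Qed.

Lemma ev1 : ev 1 1.
Proof. by have := ev_tofrac 1; rewrite tofrac1 rmorph1 hornerC. Qed.

Lemma ev_q : ev qq z.
Proof. by have := ev_tofrac 'X; rewrite map_polyX hornerX. Qed.

Lemma evN f v : ev f v -> ev (- f) (- v).
Proof.
by case=> N [D] [D0 -> ->]; exists (- N), D; rewrite tofracN rmorphN hornerN !mulNr.
Qed.

Lemma evD f v g w : ev f v -> ev g w -> ev (f + g) (v + w).
Proof.
case=> N [D] [D0 -> ->] [N' [D'] [D'0 -> ->]].
exists (N * D' + N' * D), (D * D').
rewrite !tofracD !tofracM !rmorphD !rmorphM !(hornerD, hornerM) mulf_neq0 //; split=> //.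
  by rewrite addf_div // tofrac_neq0.
by rewrite addf_div.
Qed.

Lemma evB f v g w : ev f v -> ev g w -> ev (f - g) (v - w).
Proof. by move=> fv /evN gw; apply: evD. Qed.

Lemma evM f v g w : ev f v -> ev g w -> ev (f * g) (v * w).
Proof.
case=> N [D] [D0 -> ->] [N' [D'] [D'0 -> ->]].
exists (N * N'), (D * D').
rewrite !tofracM !rmorphM !hornerM mulf_neq0 //.
by split; rewrite // invfM mulrACA.
Qed.

Lemma evV f v : ev f v -> v != 0 -> ev f^-1 v^-1.
Proof.
case=> N [D] [D0 -> ->]; rewrite mulf_eq0 negb_or => /andP[N0 _].
by exists D, N; rewrite !invf_div.
Qed.

Lemma ev_div f v g w : ev f v -> ev g w -> w != 0 -> ev (f / g) (v / w).
Proof. by move=> fv gw w0; apply: evM => //; apply: evV. Qed.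

Lemma evX f v k : ev f v -> ev (f ^+ k) (v ^+ k).
Proof.
move=> fv; elim: k => [|k IH]; first exact: ev1.
by rewrite !exprS; apply: evM.
Qed.

Lemma ev_qz (i : int) : z != 0 -> ev (qq ^ i) (z ^ i).
Proof.
move=> z0; case: i => i; first exact/evX/ev_q.
by apply: evV; [exact/evX/ev_q | rewrite expf_neq0].
Qed.

Lemma ev_sum (I : Type) (r : seq I) (F : I -> RF) (V : I -> algC) :
  (forall i, ev (F i) (V i)) -> ev (\sum_(i <- r) F i) (\sum_(i <- r) V i).
Proof.
move=> FV; elim/big_rec2: _ => [|i x y _]; last exact: evD.
by have := ev_tofrac 0; rewrite tofrac0 rmorph0 horner0.
Qed.

Lemma ev_prod (I : Type) (r : seq I) (F : I -> RF) (V : I -> algC) :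
  (forall i, ev (F i) (V i)) -> ev (\prod_(i <- r) F i) (\prod_(i <- r) V i).
Proof. by move=> FV; elim/big_rec2: _ => [|i x y _]; [exact: ev1|exact: evM]. Qed.

Lemma ev_neq0 f v : ev f v -> v != 0 -> f != 0.
Proof.
case=> N [D] [D0 -> ->]; rewrite mulf_eq0 negb_or => /andP[N0 _].
by rewrite mulf_neq0 ?invr_eq0 ?tofrac_neq0.
Qed.

Lemma ev_psi f v : ev f v -> v != 0 -> ev (psi f) (psi v).
Proof. by move=> fv v0; apply: ev_div => //; apply/evX/evB => //; exact: ev1. Qed.

Lemma ev_chi f v : ev f v -> v != 0 -> ev (chi f) (chi v).
Proof.
move=> fv v0; apply: ev_div; last by rewrite expf_neq0.
  by apply: evM; apply/evX || apply: evB; try apply: evB; try apply: evX; try exact: ev1.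
exact: evX.
Qed.

Definition regular f := exists v, ev f v.

Lemma ev_regular f v : ev f v -> regular f. Proof. by exists v. Qed.

Lemma regularM f g : regular f -> regular g -> regular (f * g).
Proof. by move=> [v fv] [w gw]; exists (v * w); exact: evM. Qed.

Lemma regularD f g : regular f -> regular g -> regular (f + g).
Proof. by move=> [v fv] [w gw]; exists (v + w); exact: evD. Qed.

Lemma regularN f : regular f -> regular (- f).
Proof. by move=> [v fv]; exists (- v); exact: evN. Qed.

Lemma regularB f g : regular f -> regular g -> regular (f - g).
Proof. by move=> rf rg; apply/regularD/regularN. Qed.

Lemma regular1 : regular 1. Proof. by exists 1; exact: ev1. Qed.

Lemma regularX f k : regular f -> regular (f ^+ k).
Proof. by move=> [v fv]; exists (v ^+ k); exact: evX. Qed.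

Lemma regular_qz (i : int) : z != 0 -> regular (qq ^ i).
Proof. by move=> z0; exists (z ^ i); exact: ev_qz. Qed.

Lemma regular_prod (I : Type) (r : seq I) (P : pred I) (F : I -> RF) :
  (forall i, P i -> regular (F i)) -> regular (\prod_(i <- r | P i) F i).
Proof.
by move=> FP; apply: big_ind => //; [exact: regular1 | exact: regularM].
Qed.

Lemma vanishM k l f g : vanish k f -> vanish l g -> vanish (k + l) (f * g).
Proof.
case=> N [D] [D0 ND ->] [N' [D'] [D'0 ND' ->]].
exists (N * N'), (D * D').
by rewrite !tofracM !rmorphM !hornerM mulf_neq0 // invfM [X in X = _]mulrACA exprD dvdp_mul.
Qed.

Lemma regular_vanish f : regular f -> vanish 0 f.
Proof. by case=> v [N [D] [D0 -> _]]; exists N, D; rewrite expr0 dvd1p. Qed.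

Lemma vanishMr k f g : vanish k f -> regular g -> vanish k (f * g).
Proof. by move=> vf /regular_vanish; move=> h; rewrite -[k]addn0; exact: vanishM. Qed.

Lemma vanishMl k f g : regular f -> vanish k g -> vanish k (f * g).
Proof. by move=> rf vg; rewrite mulrC; exact: vanishMr. Qed.

Lemma vanishD k f g : vanish k f -> vanish k g -> vanish k (f + g).
Proof.
case=> N [D] [D0 ND ->] [N' [D'] [D'0 ND' ->]].
exists (N * D' + N' * D), (D * D').
rewrite !tofracD !tofracM !rmorphD !rmorphM !(hornerD, hornerM) mulf_neq0 //; split=> //.
  by rewrite dvdp_add // dvdp_mulr.
by rewrite addf_div // tofrac_neq0.
Qed.

Lemma vanishN k f : vanish k f -> vanish k (- f).
Proof.
by case=> N [D] [D0 ND ->]; exists (- N), D; rewrite tofracN rmorphN mulNr dvdpNr.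
Qed.

Lemma vanish0 k : vanish k 0.
Proof. by exists 0, 1; rewrite rmorph1 hornerC oner_neq0 rmorph0 dvdp0 tofrac0 mul0r. Qed.

Lemma vanish_sum k (I : Type) (r : seq I) (P : pred I) (F : I -> RF) :
  (forall i, P i -> vanish k (F i)) -> vanish k (\sum_(i <- r | P i) F i).
Proof.
by move=> FP; apply: big_ind => //; [exact: vanish0 | exact: vanishD].
Qed.

Lemma vanish_leq k l f : (k <= l)%N -> vanish l f -> vanish k f.
Proof.
move=> kl [N [D] [D0 ND ->]]; exists N, D; split=> //.
exact: dvdp_trans (dvdp_exp2l _ kl) ND.
Qed.

Lemma ev0_vanish f : ev f 0 -> vanish 1 f.
Proof.
case=> N [D] [D0 -> /esym/eqP]; rewrite mulf_eq0 invr_eq0 (negPf D0) orbF => N0.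
by exists N, D; rewrite expr1 dvdp_XsubCl.
Qed.

(** The singularity is removable: cancelling [1 - x] leaves geometric sums, and the one below has
    residue [k], which is nonzero. A negative [j] only adds a unit. *)
Lemma regular_geometric (x : RF) (j : int) (k : nat) : ev x 1 -> 1 - x != 0 ->
  (0 < k)%N -> regular ((1 - x ^ j) / (1 - x ^+ k)).
Proof.
move=> ex x1 k0; have x0 := ev_neq0 ex (oner_neq0 _).
have geo i : ev (\sum_(l < i) x ^+ l) i%:R.
  rewrite -[i in i%:R]card_ord -sumr_const; apply: ev_sum => l.
  by rewrite -(expr1n _ l); apply: evX.
have subE i : 1 - x ^+ i = (1 - x) * \sum_(l < i) x ^+ l.
  by rewrite -opprB subrX1 -mulNr opprB.
have nat_case (i : nat) : regular ((1 - x ^+ i) / (1 - x ^+ k)).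
  have cancel (L : fieldType) (c u v : L) : c != 0 -> c * u / (c * v) = u / v.
    by move=> c0; rewrite invfM mulrACA divff // mul1r.
  rewrite (subE i) (subE k) (cancel _ _ _ _ x1); exists (i%:R / k%:R).
  by apply: ev_div; rewrite ?pnatr_eq0 -?lt0n.
case: j => i; first exact: nat_case.
rewrite NegzE -exprz_inv -exprnP.
have xi0 : x ^+ i.+1 != 0 by rewrite expf_neq0.
rewrite exprVn (_ : 1 - (x ^+ i.+1)^-1 = - (x ^+ i.+1)^-1 * (1 - x ^+ i.+1)); last first.
  by rewrite mulrBr mulr1 mulNr mulVf // opprK addrC.
rewrite -mulrA; apply: regularM => //; apply: regularN.
exists (1 ^+ i.+1)^-1; apply: evV; first exact: evX.
by rewrite expr1n oner_neq0.
Qed.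

End LocalRing.

(** * Vanishing at roots of unity *)

Lemma prim_root_exprz (L : fieldType) (y : L) (e : nat) (j : int) :
  e.-primitive_root y -> (0 < e)%N -> y ^ j = 1 -> exists i : int, j = e%:Z * i.
Proof.
move=> ye e0 yj; exists (j %/ e)%Z.
have y0 : y != 0 by rewrite (prim_root_eq0 ye) -lt0n.
have ez : e%:Z != 0 by rewrite eqz_nat -lt0n.
have := modz_ge0 j ez; case E : (j %% e)%Z => [i|//] _.
have := divz_eq j e; rewrite E => jE.
have : y ^+ i = 1.
  move: yj; rewrite {1}jE expfzDr // -exprz_exp exprzAC.
  by rewrite -[y ^ e]exprnP (prim_expr_order ye) exp1rz mul1r.
move/eqP; rewrite -(prim_order_dvd ye) => ei.
have : (i < e)%N by have := ltz_pmod j (d := e%:Z); rewrite E ltz_nat; apply.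
move=> ie; have i0 : i = 0%N.
  by apply/eqP; rewrite -leqn0 leqNgt; apply/negP => /dvdn_leq /(_ ei); rewrite leqNgt ie.
by rewrite {1}jE i0 addr0 mulrC.
Qed.

Lemma qq_neq0 : qq != 0. Proof. by rewrite tofrac_eq0 polyX_eq0. Qed.

Lemma qq_exprz_eq1 (i : int) : qq ^ i = 1 -> i = 0.
Proof.
have key (k : nat) : qq ^+ k = 1 -> k = 0%N.
  rewrite -tofracXn -tofrac1 => /eqP; rewrite tofrac_eq => /eqP /(congr1 (size \o val)) /=.
  by rewrite size_polyXn size_poly1 => -[].
case: i => k; first by move/key => ->.
rewrite NegzE -exprz_inv -exprnP exprVn => h.
by have /key : qq ^+ k.+1 = 1 by rewrite -[LHS]invrK h invr1.
Qed.

Lemma qq_exprz_neq1 (i : int) : i != 0 -> 1 - qq ^ i != 0.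
Proof. by apply: contraNneq => /eqP; rewrite subr_eq0 eq_sym => /eqP /qq_exprz_eq1 ->. Qed.

Lemma qq_sqr (t : int) : (qq ^ t) ^+ 2 = qq ^ (2 * t).
Proof. by rewrite exprnP exprz_exp mulrC. Qed.

Lemma qq_sqr_add1_neq0 (t : int) : t != 0 -> 1 + (qq ^ t) ^+ 2 != 0.
Proof.
move=> t0; apply/eqP => h1.
have hN : (qq ^ t) ^+ 2 = -1 by apply/eqP; rewrite -addr_eq0 addrC h1.
have : ((qq ^ t) ^+ 2) ^+ 2 = 1 by rewrite hN sqrrN expr1n.
rewrite -exprM exprnP exprz_exp => /qq_exprz_eq1 /eqP.
by rewrite mulf_eq0 (negPf t0).
Qed.

(** Serves the case where [1 + x] vanishes at [z]: it is cancelled against the first factor of the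
    numerator. *)
Lemma rhs_factor_split (L : fieldType) (x X Y y : L) : 1 + x != 0 ->
  (1 - x ^+ 2) * X / (Y * y) / (1 + x) = (1 - x) * (X / Y) / y.
Proof. by move=> x1; rewrite invfM; move: Y^-1 y^-1 => U V; field. Qed.

Lemma perturb_term_split (R : comNzRingType) (c X Y H W : R) : c * X ^+ 2 - c * (X * Y) =
  - (W * (c * X ^+ 2 * H) + c * X * (Y - X * (1 + W * H))).
Proof. ring. Qed.

Lemma qpochD (x y : RF) k s : qpoch x y (k + s) = qpoch x y k * qpoch (x * y ^+ k) y s.
Proof.
rewrite /qpoch big_split_ord /=; congr (_ * _); apply: eq_bigr => i _.
by rewrite exprD mulrA.
Qed.

(** * Regularity and block cancellation at a root of unity *)

Section AtPrimitiveRoot.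
Variables (z : algC) (e d : nat).
Hypothesis z_prim : e.-primitive_root (z ^+ 2).
Hypothesis e_gt1 : (1 < e)%N.
Hypothesis co_de : coprime d e.
Hypothesis d_gt0 : (0 < d)%N.

Local Notation p := (qq ^+ (2 * d)).
Local Notation pz := (z ^+ (2 * d)).

Lemma z_neq0 : z != 0.
Proof.
have : z ^+ 2 != 0 by rewrite (prim_root_eq0 z_prim) -lt0n ltnW.
by rewrite expf_eq0.
Qed.

Lemma pz_prim : e.-primitive_root pz.
Proof. by rewrite exprM prim_root_exp_coprime. Qed.

Lemma pz_neq1 (i : nat) : ~~ (e %| i)%N -> 1 - pz ^+ i != 0.
Proof.
by apply: contraNN; rewrite subr_eq0 eq_sym -(prim_order_dvd pz_prim).
Qed.

Lemma ev_p : ev z p pz. Proof. exact/evX/ev_q. Qed.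

Lemma ev_pX i : ev z (p ^+ i) (pz ^+ i). Proof. exact/evX/ev_p. Qed.

Lemma ev1B f v : ev z f v -> ev z (1 - f) (1 - v).
Proof. by move=> fv; apply: evB => //; exact: ev1. Qed.

Lemma ev_qpoch x xz k : ev z x xz -> ev z (qpoch x p k) (\prod_(i < k) (1 - xz * pz ^+ i)).
Proof. by move=> xv; apply: ev_prod => i; apply: ev1B; apply: evM => //; exact: ev_pX. Qed.

(* In each period of [e] consecutive indices exactly one factor of the numerator and one of
   the denominator vanish at [z]. *)
Lemma regular_qpoch_ratio (s : int) (k : nat) :
  regular z (qpoch (qq ^ (2 * s)) p k / qpoch p p k).
Proof.
have zn := z_neq0.
have den r i : (i < e)%N -> regular z (qpoch (p * p ^+ (r * e)) p i)^-1.
  move=> ie; eexists; apply: evV.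
    apply: ev_qpoch; rewrite -exprS; exact: ev_pX.
  apply/prodf_neq0 => j _; rewrite -exprD; apply: pz_neq1.
  have -> : ((r * e).+1 + j = j.+1 + r * e)%N by lia.
  rewrite dvdn_addl ?dvdn_mull //; apply/negP => /dvdn_leq; have := ltn_ord j; lia.
have num (x : int) i : regular z (qpoch (qq ^ x) p i).
  by eexists; apply: ev_qpoch; exact: ev_qz.
have pE i : p ^+ i = qq ^ (2 * d * i)%N%:Z by rewrite -exprM.
rewrite [k](divn_eq k e); move: (k %/ e)%N (k %% e)%N (ltn_pmod k (ltnW e_gt1)) => r i ie.
rewrite !qpochD invfM mulrACA.
apply: regularM; last first.
  by apply: regularM; [rewrite (pE (r * e)%N) -expfzDr ?qq_neq0 //; exact: num | exact: den].
elim: r {i ie} => [|r IH].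
  by rewrite mul0n /qpoch !big_ord0 divr1; exact: regular1.
rewrite [(r.+1 * e)%N]mulSnr !qpochD invfM mulrACA; apply: regularM => //.
(* The index [j0] locates the numerator factor of this block that vanishes at [z]; it has the form 1
   - q^(2eJ). *)
have z2s : z ^ (2 * s) = (z ^+ 2) ^ s by rewrite -exprz_exp.
have [j0 j0E] : {j0 : 'I_e | (z ^ (2 * s))^-1 = pz ^+ j0}.
  apply: (prim_rootP pz_prim).
  by rewrite exprVn z2s exprnP exprzAC -exprnP (prim_expr_order z_prim) exp1rz invr1.
have [J JE] : exists J : int, s + (d * (r * e + j0))%N%:Z = e%:Z * J.
  apply: (prim_root_exprz z_prim); first lia.
  rewrite expfzDr ?expf_neq0 // -z2s -exprnP -exprM mulnA exprM exprD.
  rewrite [(r * e)%N]mulnC [pz ^+ (e * r)]exprM.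
  rewrite (prim_expr_order pz_prim) expr1n mul1r -j0E divff //.
  by rewrite expfz_neq0.
rewrite /qpoch (bigD1 j0) //.
(* In the denominator the vanishing factor is the last one of the block. It is paired with factor
   [j0], both being of the form 1 - x^i with x = q^(2e). *)
have recr (F : nat -> RF) : \prod_(i < e) F i = \prod_(i < e.-1) F i * F e.-1.
  by rewrite -[in LHS](prednK (ltnW e_gt1)) big_ord_recr.
rewrite [X in _ / X](recr (fun i => 1 - p * p ^+ (r * e) * p ^+ i)).
rewrite [X in _ / X]mulrC invfM mulrACA; apply: regularM; last first.
  apply: regularM; last by apply: den; lia.
  apply: regular_prod => i _; rewrite !pE -!expfzDr ?qq_neq0 //.
  by eexists; apply: ev1B; exact: ev_qz.
have -> : qq ^ (2 * s) * p ^+ (r * e) * p ^+ j0 = (qq ^+ (2 * e)) ^ J.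
  rewrite !pE -!expfzDr ?qq_neq0 // exprnP exprz_exp; congr (_ ^ _); lia.
have -> : p * p ^+ (r * e) * p ^+ e.-1 = (qq ^+ (2 * e)) ^+ (d * r.+1).
  rewrite -exprS -exprD -!exprM; congr (_ ^+ _); lia.
apply: regular_geometric; last lia.
  have := evX (2 * e) (ev_q z).
  by rewrite [z ^+ (2 * e)]exprM (prim_expr_order z_prim).
rewrite exprnP; apply: qq_exprz_neq1; lia.
Qed.

Variables (t : int) (m : nat).
Local Notation h := (qq ^ t).
Local Notation hz := (z ^ t).
Local Notation a := (h ^+ 2).
Local Notation az := (hz ^+ 2).
Hypothesis az_pz : az * pz ^+ m = 1.

Let z0 : z != 0 := z_neq0.
Let pz0 i : pz ^+ i != 0. Proof. by rewrite !expf_neq0. Qed.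
Let pzn0 : pz != 0. Proof. exact: (pz0 1). Qed.
Let hz0 : hz != 0. Proof. by rewrite expfz_neq0. Qed.
Let az0 : az != 0. Proof. by rewrite expf_neq0. Qed.
Let p0 : p != 0. Proof. by rewrite expf_neq0 ?qq_neq0. Qed.
Let h0 : h != 0. Proof. by rewrite expfz_neq0 ?qq_neq0. Qed.
Let a0 : a != 0. Proof. by rewrite expf_neq0. Qed.
Let ev_h : ev z h hz. Proof. exact: ev_qz. Qed.
Let ev_a : ev z a az. Proof. exact: evX. Qed.
Let pz_mod i : pz ^+ (i %% e) = pz ^+ i.
Proof. exact: prim_expr_mod (pz_prim) _. Qed.
Let pz_blk r i : pz ^+ (r * e + i) = pz ^+ i.
Proof. by rewrite -pz_mod modnMDl pz_mod. Qed.
Let pz1 i : (0 < i < e)%N -> 1 - pz ^+ i != 0.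
Proof.
move=> ie; apply: pz_neq1; apply/negP => /dvdn_leq; lia.
Qed.
Let az_pz_mod : az * pz ^+ (m %% e) = 1.
Proof. by rewrite pz_mod. Qed.

Lemma regular_psi_prod k : regular z (psi_prod a p 0 k).
Proof.
rewrite (psi_prod0_sqr k p0 a0); apply: regularM; last first.
  by apply: regularX; exists (pz / az); apply: ev_div => //; exact: ev_p.
by apply: regularX; rewrite qq_sqr; exact: regular_qpoch_ratio.
Qed.

Let ev_chi_h i : ev z (chi (h * p ^+ i)) (chi (hz * pz ^+ i)).
Proof. by apply: ev_chi; [apply: evM => //; exact: ev_pX | rewrite mulf_neq0]. Qed.

Lemma ev_psi_block r s : (s < e)%N ->
  ev z (\prod_(i < s) (psi (a * p ^+ (r * e + i)) / psi (p ^+ (r * e + i).+1)))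
       (psi_prod az pz 0 s).
Proof.
move=> se; apply: ev_prod => i; rewrite !subr0 -addnS -(pz_blk r i) -(pz_blk r i.+1).
apply: ev_div; last by rewrite psi_neq0 // pz_blk pz1 //; have := ltn_ord i; lia.
  by apply: ev_psi; [apply: evM => //; exact: ev_pX | rewrite mulf_neq0].
by apply: ev_psi => //; exact: ev_pX.
Qed.

Lemma psi_prod_az_eq0 s : (m %% e < s)%N -> psi_prod az pz 0 s = 0.
Proof.
move=> ms; rewrite /psi_prod (bigD1 (Ordinal ms)) //= az_pz_mod.
by rewrite /psi subrr expr0n !(mul0r, subrr).
Qed.

(** The product up to the start of the block is a common regular factor. What remains reduces at [z]
    to the antisymmetric sum over [s <= m %% e], later terms having residue zero. The range of [l]
    covers both complete blocks and the truncated last one. *)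
Lemma block_vanish r l : (m %% e < l <= e)%N ->
  vanish z 1 (\sum_(s < l) chi (h * p ^+ (r * e + s)) * psi_prod a p 0 (r * e + s) ^+ 2).
Proof.
move=> /andP[ml le].
under eq_bigr do rewrite psi_prodD exprMn mulrCA.
rewrite -mulr_sumr; apply: vanishMl; first exact/regularX/regular_psi_prod.
apply: ev0_vanish.
have <- : \sum_(s < l) chi (hz * pz ^+ s) * psi_prod az pz 0 s ^+ 2 = 0.
  rewrite -(big_mkord xpredT (fun s => chi (hz * pz ^+ s) * psi_prod az pz 0 s ^+ 2)).
  rewrite (big_cat_nat (n := (m %% e).+1)) //=.
  rewrite [X in _ + X]big1_seq => [|i /andP[_]]; last first.
    rewrite mem_index_iota => /andP[mi _].
    by rewrite psi_prod_az_eq0 // expr0n mulr0.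
  rewrite addr0; apply: etrans (@chi_sum_antisym _ hz pz (m %% e) (fun=> 1) _ _ _ _ _) => //.
  - by apply: eq_bigr => i _; rewrite mulr1.
  - by rewrite pnatr_eq0.
  - by move=> i im; apply: pz1; have := ltn_pmod m (ltnW e_gt1); lia.
apply: ev_sum => s; apply: evM; first by rewrite -(pz_blk r).
by apply: evX; apply: ev_psi_block; exact: leq_trans (ltn_ord s) le.
Qed.

Lemma blocks_vanish r : vanish z 1
  (\sum_(0 <= k < r * e) chi (h * p ^+ k) * psi_prod a p 0 k ^+ 2).
Proof.
have me := ltn_pmod m (ltnW e_gt1).
elim: r => [|r IH]; first by rewrite big_geq //; exact: vanish0.
rewrite (big_cat_nat (n := (r * e)%N)) //=; last by rewrite mulSn leq_addl.
apply: vanishD => //.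
rewrite -{1}[(r * e)%N]add0n big_addn mulSn addnK big_mkord.
under eq_bigr do rewrite addnC.
by apply: block_vanish; rewrite me leqnn.
Qed.

Lemma truncated_sum_vanish : vanish z 1
  (\sum_(0 <= k < m.+1) chi (h * p ^+ k) * psi_prod a p 0 k ^+ 2).
Proof.
have me := ltn_pmod m (ltnW e_gt1).
have mE := divn_eq m e.
rewrite (big_cat_nat (n := (m %/ e * e)%N)) //=; last by lia.
apply: vanishD; first exact: blocks_vanish.
rewrite -{1}[(m %/ e * e)%N]add0n big_addn big_mkord.
under eq_bigr do rewrite addnC.
apply: block_vanish; lia.
Qed.

(** The delicate case is residue -1 for [a]. Then [e] does not divide [m], as otherwise the residue
    would be 1; so [1 + a] cancels into [1 - a ^+ 2], the last denominator factor is a unit, and a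
    Pochhammer quotient of length [m - 1] is left. *)
Lemma regular_rhs_factor : t != 0 ->
  regular z (qpoch (a ^+ 2) p m / qpoch p p m / (1 + a)).
Proof.
move=> t0.
have a2E : a ^+ 2 = qq ^ (2 * (2 * t)) by rewrite qq_sqr exprnP exprz_exp; congr (_ ^ _); ring.
have a1 := qq_sqr_add1_neq0 t0.
have [az1|az1] := eqVneq (1 + az) 0; last first.
  apply: regularM; first by rewrite a2E; exact: regular_qpoch_ratio.
  by exists (1 + az)^-1; apply: evV => //; apply: evD => //; exact: ev1.
have mn0 : ~~ (e %| m)%N.
  apply/negP => /dvdnP[r mE]; have := az_pz; rewrite mE.
  rewrite -[(r * e)%N]addn0 pz_blk expr0 mulr1 => az_1.
  by move/eqP: az1; rewrite az_1 -mulr2n pnatr_eq0.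
case: m mn0 => [|k]; first by rewrite dvdn0.
move=> kn.
have -> : qpoch (a ^+ 2) p k.+1 = (1 - a ^+ 2) * qpoch (a ^+ 2 * p) p k.
  rewrite /qpoch big_ord_recl mulr1; congr (_ * _); apply: eq_bigr => i _.
  by rewrite lift0 [p ^+ i.+1]exprS [a ^+ 2 * (p * _)]mulrA.
rewrite [qpoch p p k.+1]/qpoch big_ord_recr -/(qpoch p p k) -[p * p ^+ _]exprS.
rewrite rhs_factor_split //; apply: regularM.
  apply: regularM; first by eexists; apply: ev1B; exact: ev_a.
  have -> : a ^+ 2 * p = qq ^ (2 * (2 * t + d%:Z)).
    by rewrite a2E exprnP -expfzDr ?qq_neq0 //; congr (_ ^ _); lia.
  exact: regular_qpoch_ratio.
by eexists; apply: evV; [apply: ev1B; exact: ev_pX | exact: pz_neq1].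
Qed.

(** * Third-order vanishing when m < e *)

Section FullOrder.
Hypothesis m_lt_e : (m < e)%N.
Local Notation eps := (a * p ^+ m).
Local Notation w := (psi eps).

Lemma ev_eps : ev z eps 1.
Proof. by rewrite -az_pz; apply: evM => //; exact: ev_pX. Qed.

Lemma vanish_w : vanish z 2 w.
Proof.
apply: vanishMr; last first.
  by exists 1^-1; apply: evV; [exact: ev_eps | rewrite oner_neq0].
have v : vanish z 1 (1 - eps).
  by apply: ev0_vanish; rewrite -(subrr 1); apply: ev1B; exact: ev_eps.
exact: (@vanishM _ 1 1 _ _ v v).
Qed.

Let ev_w : ev z w 0.
Proof. by have := ev_psi ev_eps (oner_neq0 _); rewrite /psi subrr expr0n mul0r. Qed.

Let az_pz_neq1 i : (i < m)%N -> 1 - az * pz ^+ i != 0.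
Proof.
move=> im; have mi : (0 < m - i < e)%N by lia.
apply: contraNneq (pz1 mi) => /eqP; rewrite subr_eq0 => /eqP E.
have : az * (pz ^+ (m - i) * pz ^+ i) = 1 by rewrite -exprD subnK // ltnW.
by rewrite mulrCA -E mulr1 => ->; rewrite subrr.
Qed.

Let ev_psi_p i : ev z (psi (p ^+ i)) (psi (pz ^+ i)).
Proof. by apply: ev_psi => //; exact: ev_pX. Qed.
Let ev_psi_a i : ev z (psi (a * p ^+ i)) (psi (az * pz ^+ i)).
Proof. by apply: ev_psi; [apply: evM => //; exact: ev_pX | rewrite mulf_neq0]. Qed.
Let psi_pz_neq0 i : (0 < i < e)%N -> psi (pz ^+ i) != 0.
Proof. by move=> ie; rewrite psi_neq0 // pz1. Qed.
Let psi_az_neq0 i : (i < m)%N -> psi (az * pz ^+ i) != 0.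
Proof. by move=> im; rewrite psi_neq0 ?mulf_neq0 // az_pz_neq1. Qed.

Lemma ev_psi_harm k : (k <= m)%N -> ev z (psi_harm a p k) (psi_harm az pz k).
Proof.
move=> km; apply: ev_sum => i; have := ltn_ord i => ik.
by apply: evB; apply: evV => //; [apply: psi_pz_neq0 | apply: psi_az_neq0]; lia.
Qed.

(** As [k <= m < e], every [psi] value involved is a unit at [z], so the Taylor remainders
    accumulate without losing regularity. *)
Lemma psi_prod_perturb k : (k <= m)%N -> exists2 G, regular z G &
  psi_prod a p w k - psi_prod a p 0 k * (1 + w * psi_harm a p k) = w ^+ 2 * G.
Proof.
elim: k => [|k IH] km.
  exists 0; first by have := ev_tofrac z 0; rewrite tofrac0; exact: ev_regular.
  by rewrite /psi_prod /psi_harm !big_ord0 !mulr0 addr0 mulr1 subrr.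
have [G rG GE] := IH (ltnW km).
have ex := ev_psi_a k; have x0 := psi_az_neq0 km.
have ey := ev_psi_p k.+1; have y0 : psi (pz ^+ k.+1) != 0 by apply: psi_pz_neq0; lia.
have eyw : ev z (psi (p ^+ k.+1) - w) (psi (pz ^+ k.+1)).
  by rewrite -[psi (pz ^+ _)]subr0; apply: evB.
rewrite !psi_prodS !subr0 [psi_harm _ _ k.+1]/psi_harm big_ord_recr /= -/(psi_harm a p k).
have st := psi_prod_perturb_step (ev_neq0 ex x0) (ev_neq0 ey y0) (ev_neq0 eyw y0).
rewrite (psi_prod_perturb_comb st GE erefl); eexists; last reflexivity.
have rw := ev_regular ev_w.
have reta : regular z ((psi (p ^+ k.+1))^-1 - (psi (a * p ^+ k))^-1).
  by apply: regularB; eexists; apply: evV; eassumption.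
have rH := ev_regular (ev_psi_harm (ltnW km)).
have ryw : regular z (psi (p ^+ k.+1) - w)^-1 by eexists; apply: evV; eassumption.
apply: regularD.
  apply: regularM => //; apply: regularM => //; apply: regularB => //; exact: ev_regular ex.
apply: regularM.
  apply: regularM; first exact: regular_psi_prod.
  by eexists; apply: ev_div; eassumption.
apply: regularD; first exact: regularM.
apply: regularM; first exact: regularM.
by apply: regularD; [exact: regular1 | exact: regularM].
Qed.

(** The first-order part is [w] times a harmonic-weighted sum, of order 2 + 1 by antisymmetry; the
    remainders carry [w ^+ 2], of order 4. *)
Lemma perturbation_vanish : vanish z 3
  (\sum_(0 <= k < m.+1) chi (h * p ^+ k) * psi_prod a p 0 k ^+ 2
   - \sum_(0 <= k < m.+1) chi (h * p ^+ k) * (psi_prod a p 0 k * psi_prod a p w k)).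
Proof.
set S := \sum_(0 <= k < m.+1) chi (h * p ^+ k) * psi_prod a p 0 k ^+ 2 * psi_harm a p k.
rewrite -sumrB.
have -> : \sum_(0 <= k < m.+1) (chi (h * p ^+ k) * psi_prod a p 0 k ^+ 2
    - chi (h * p ^+ k) * (psi_prod a p 0 k * psi_prod a p w k)) =
  - (w * S + \sum_(0 <= k < m.+1) chi (h * p ^+ k) * psi_prod a p 0 k *
      (psi_prod a p w k - psi_prod a p 0 k * (1 + w * psi_harm a p k))).
  rewrite mulr_sumr -big_split -sumrN; apply: eq_bigr => k _ /=.
  exact: perturb_term_split.
apply: vanishN; apply: vanishD.
  apply: (@vanishM _ 2 1); first exact: vanish_w.
  apply: ev0_vanish; rewrite /S.
  have <- : \sum_(k < m.+1) chi (hz * pz ^+ k) * psi_prod az pz 0 k ^+ 2 * psi_harm az pz k = 0.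
    rewrite -(big_mkord xpredT (fun k => chi (hz * pz ^+ k)
      * psi_prod az pz 0 k ^+ 2 * psi_harm az pz k)).
    apply: chi_sum_antisym => //; first by rewrite pnatr_eq0.
      by move=> i im; apply: pz1; lia.
    by move=> k km; apply: psi_harm_sym.
  rewrite big_mkord; apply: ev_sum => k; have km : (k <= m)%N by rewrite -ltnS.
  apply: evM; last exact: ev_psi_harm.
  apply: evM => //; apply: evX.
  have := @ev_psi_block 0 k (leq_ltn_trans km m_lt_e).
  by rewrite /psi_prod; under eq_bigr do rewrite mul0n add0n -[psi _]subr0 -[X in _ / X]subr0.
rewrite big_mkord; apply: vanish_sum => k _; have km : (k <= m)%N by rewrite -ltnS.
have [G rG ->] := psi_prod_perturb km.
apply: vanishMl.
  by apply: regularM; [exact: ev_regular (ev_chi_h k) | exact: regular_psi_prod].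
apply: vanishMr => //; apply: (@vanish_leq _ 3 4) => //.
exact: (@vanishM _ 2 2 _ _ vanish_w vanish_w).
Qed.

(** Beyond [m] the product contains the factor [psi (a * p ^+ m) = w] of order 2, while its
    denominators stay units because [k < e]. Squaring gives order 4. *)
Lemma tail_vanish k : (m < k < e)%N ->
  vanish z 3 (chi (h * p ^+ k) * psi_prod a p 0 k ^+ 2).
Proof.
move=> /andP[mk ke]; apply: vanishMl; first exact: ev_regular (ev_chi_h k).
apply: (@vanish_leq _ 3 4) => //.
suff v : vanish z 2 (psi_prod a p 0 k) by apply: (@vanishM _ 2 2).
rewrite /psi_prod (bigD1 (Ordinal mk)) //= !subr0; apply: vanishMr.
  apply: vanishMr; first exact: vanish_w.
  by eexists; apply: evV; [exact: ev_psi_p | apply: psi_pz_neq0; lia].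
apply: regular_prod => i _; rewrite !subr0; have ik := ltn_ord i.
by eexists; apply: ev_div => //; apply: psi_pz_neq0; lia.
Qed.
End FullOrder.
End AtPrimitiveRoot.

(** * Congruences modulo a polynomial *)

(** Induction on the degree: a common linear factor is removed from [P] and [N], which lowers the
    multiplicity by one at that root and keeps the others. *)
Lemma dvdp_multiplicities (L : closedFieldType) (P N : {poly L}) : P != 0 ->
    (forall z k, ('X - z%:P) ^+ k %| P -> ('X - z%:P) ^+ k %| N) -> P %| N.
Proof.
have [s] := ubnP (size P); elim: s P N => // s IH P N sP P0 PN.
have [P1|/closed_rootP [z]] := eqVneq (size P) 1%N.
  by move/eqP: P1; rewrite size_poly_eq1 => /eqp_dvdl ->; rewrite dvd1p.
move=> /factor_theorem [P' PE].
have /dvdpP[N' NE] : 'X - z%:P %| N.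
  by rewrite -['X - _]expr1; apply: PN; rewrite expr1 PE dvdp_mulIr.
have X0 : 'X - z%:P != 0 by rewrite polyXsubC_eq0.
have P'0 : P' != 0 by apply: contraNneq P0 => P'0; rewrite PE P'0 mul0r.
rewrite PE NE dvdp_mul2r //; apply: IH => //.
  by move: sP; rewrite PE size_mul // size_XsubC addn2 /= ltnS.
move=> y k ykP'; have [yz|yz] := eqVneq y z.
  have := PN z k.+1; rewrite yz in ykP' *; rewrite PE NE exprSr !dvdp_mul2r //.
  exact.
have := PN y k; rewrite PE NE dvdp_mulr // => /(_ isT).
by rewrite Gauss_dvdpl // coprimep_expl // coprimep_XsubC root_XsubC eq_sym.
Qed.

(** The local conditions provide a different fraction at each root, whereas [cong_mod] asks for a
    single one. The fraction in lowest terms serves all roots, by cross-multiplication with the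
    local ones. *)
Lemma cong_mod_vanish (A B : RF) (P : {poly rat}) : (1 < size P)%N ->
    (forall z k, (0 < k)%N -> ('X - z%:P) ^+ k %| Cpoly P -> vanish z k (A - B)) ->
  cong_mod A B P.
Proof.
move=> sP vAB; have P0 : P != 0 by rewrite -size_poly_gt0 ltnW.
have vroot z : root (Cpoly P) z -> vanish z 1 (A - B).
  by move=> Pz; apply: vAB => //; rewrite expr1 dvdp_XsubCl.
have [z0 Pz0] : exists z, root (Cpoly P) z.
  by apply/closed_rootP; rewrite size_map_poly gtn_eqF.
have [N0 [D0 [D0z _ AB0]]] := vroot z0 Pz0.
have nzD0 : D0 != 0 by apply: contraNneq D0z => ->; rewrite rmorph0 horner0.
set g := gcdp N0 D0.
have g0 : g != 0 by rewrite gcdp_eq0 negb_and nzD0 orbT.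
pose N := N0 %/ g; pose D := D0 %/ g.
have N0E : N0 = N * g by rewrite divpK ?dvdp_gcdl.
have D0E : D0 = D * g by rewrite divpK ?dvdp_gcdr.
have nzD : D != 0 by apply: contraNneq nzD0 => DE; rewrite D0E DE mul0r.
have coND : coprimep N D by rewrite coprimep_div_gcd // nzD0 orbT.
have AB : A - B = N%:F / D%:F.
  have gF : g%:F != 0 by rewrite tofrac_eq0.
  by rewrite AB0 N0E D0E !tofracM invfM mulrACA divff ?mulr1.
have cross N1 D1 : D1 != 0 -> A - B = N1%:F / D1%:F -> N1 * D = N * D1.
  move=> nzD1; rewrite AB => /eqP; rewrite eqr_div ?tofrac_eq0 // -!tofracM tofrac_eq.
  by move/eqP.
exists N, D; split=> //.
- rewrite -(coprimep_map (ratr : {rmorphism rat -> algC})) coprimep_sym.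
  apply/Pdiv.ClosedField.coprimepP => z Pz; have [N1 [D1 [D1z _ E1]]] := vroot z Pz.
  have nzD1 : D1 != 0 by apply: contraNneq D1z => ->; rewrite rmorph0 horner0.
  apply/negP => Dz; have : (Cpoly N).[z] != 0.
    by apply: coprimep_root Dz; rewrite coprimep_map coprimep_sym.
  have := congr1 (fun p => (Cpoly p).[z]) (cross _ _ nzD1 E1).
  rewrite !rmorphM !hornerM (eqP Dz) mulr0 => /esym/eqP.
  by rewrite mulf_eq0 (negPf D1z) orbF => ->.
- rewrite -(dvdp_map (ratr : {rmorphism rat -> algC})).
  apply: dvdp_multiplicities; first by rewrite map_poly_eq0.
  move=> z [|k] zkP; first by rewrite expr0 dvd1p.
  have [N1 [D1 [D1z zN1 E1]]] := vAB z k.+1 isT zkP.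
  have nzD1 : D1 != 0 by apply: contraNneq D1z => ->; rewrite rmorph0 horner0.
  have := dvdp_mulr (Cpoly D) zN1; rewrite -rmorphM (cross _ _ nzD1 E1) rmorphM.
  by rewrite Gauss_dvdpl // coprimep_expl // coprimep_sym coprimep_XsubC.
Qed.

(** * Roots of the modulus and their multiplicities *)

Lemma Cpoly_qint2 n : Cpoly (qint2_poly n) * ('X ^+ 2 - 1) = 'X ^+ (2 * n) - 1.
Proof.
rewrite [in RHS]exprM [RHS]subrX1 [RHS]mulrC /qint2_poly rmorph_sum /=; congr (_ * _).
by apply: eq_bigr => i _; rewrite map_polyXn exprM.
Qed.

Lemma Cpoly_PhiQ2_dvd n : (0 < n)%N -> Cpoly (PhiQ2 n) %| 'X ^+ (2 * n) - 1.
Proof.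
move=> n0.
have E : \prod_(d <- divisors n) Cpoly (PhiQ2 d) = 'X ^+ (2 * n) - 1.
  have := congr1 (fun p => Cpoly (map_poly (intr : int -> rat) p \Po 'X ^+ 2))
    (prod_Cyclotomic n0).
  rewrite /PhiQ2 !rmorph_prod /= => ->.
  rewrite rmorphB rmorph1 /= map_polyXn comp_polyB comp_polyC comp_Xn_poly -exprM.
  by rewrite rmorphB rmorph1 /= map_polyXn.
rewrite -E (big_rem n) /=; first exact: dvdp_mulr.
by rewrite -dvdn_divisors.
Qed.

Lemma root_PhiQ2 n z : (0 < n)%N -> root (Cpoly (PhiQ2 n)) z = n.-primitive_root (z ^+ 2).
Proof.
move=> n0; have [x xn] := C_prim_root_exists n0.
rewrite -(root_cyclotomic xn) -(Cintr_Cyclotomic xn) /PhiQ2 map_comp_poly map_polyXn.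
rewrite /root horner_comp !hornerE -map_poly_comp.
by rewrite (eq_map_poly (g := intr)) // => i; rewrite /= ratr_int.
Qed.

(** Both [qint2_poly n] and [PhiQ2 n] divide the separable polynomial X^(2n) - 1, so their roots are
    simple. A root of [PhiQ2 n] thus counts at most 1 + 2 times, any other root once. *)
Lemma modulus_multiplicity n z k : (1 < n)%N -> (0 < k)%N ->
    ('X - z%:P) ^+ k %| Cpoly (qint2_poly n * PhiQ2 n ^+ 2) ->
  exists e, [/\ e.-primitive_root (z ^+ 2), (1 < e)%N, (e %| n)%N
    & (k <= if e == n then 3 else 1)%N].
Proof.
move=> n1 k0; rewrite rmorphM rmorphXn /=.
set U := Cpoly (qint2_poly n); set V := Cpoly (PhiQ2 n) => zk.
have n0 := ltnW n1.
have sep : separable_poly ('X ^+ (2 * n) - 1 : {poly algC}).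
  by apply: separable_Xn_sub_1; rewrite pnatr_eq0; lia.
have X0 : 'X ^+ (2 * n) - 1 != 0 :> {poly algC}.
  by rewrite monic_neq0 // monicXnsubC //; lia.
have simple W : W %| 'X ^+ (2 * n) - 1 -> W != 0 /\ (mup z W <= 1)%N.
  move=> WX; have W0 : W != 0 by apply: dvdpN0 WX X0.
  split=> //; rewrite mup_leq //; apply/negP => /dvdp_trans /(_ WX).
  by rewrite separable_nosquare // size_XsubC.
have UX : U %| 'X ^+ (2 * n) - 1 by rewrite -Cpoly_qint2 dvdp_mulr.
have VX : V %| 'X ^+ (2 * n) - 1 by exact: Cpoly_PhiQ2_dvd.
have [U0 mU] := simple _ UX; have [V0 mV] := simple _ VX.
have UV0 : U * V ^+ 2 != 0 by rewrite mulf_neq0 // expf_neq0.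
move: zk; rewrite -mup_geq // !mupM ?expf_neq0 // => zk.
have [Vz|Vz] := boolP (root V z).
  exists n; rewrite eqxx dvdnn -root_PhiQ2 //; split=> //.
  by rewrite (leq_trans zk) //; lia.
rewrite (mupNroot Vz) !addn0 in zk.
have Uz : root U z by rewrite -dvdp_XsubCl XsubC_dvd //; lia.
have zn : (z ^+ 2) ^+ n = 1.
  have := congr1 (horner^~ z) (Cpoly_qint2 n); rewrite -/U /= hornerM (eqP Uz) mul0r.
  by rewrite !hornerE -exprM => /eqP; rewrite eq_sym subr_eq0 => /eqP.
have [e ze en] := prim_order_exists n0 zn.
exists e; split=> //; last by rewrite (leq_trans zk) // (leq_trans mU) //; case: ifP.
(* If [z ^+ 2] were 1, [qint2_poly n] would take the value [n] at [z], which is nonzero. *)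
rewrite ltn_neqAle (dvdn_gt0 n0 en) andbT; apply/eqP => e1.
move: Uz; rewrite /root /U rmorph_sum horner_sum.
have z1 : z ^+ 2 = 1 by have := prim_expr_order ze; rewrite -e1 expr1.
under eq_bigr do rewrite /= map_polyXn hornerXn exprM z1 expr1n.
by rewrite sumr_const card_ord pnatr_eq0; lia.
Qed.

(** * The summand and the right-hand side in terms of psi and chi *)

Lemma summand_shape (L : fieldType) (P A c1 c2 X Y h : L) : h != 0 -> P != 0 ->
  (1 - (h * P) ^+ 2) / c2 * ((1 - h * P) / c1) ^+ 2 * X ^+ 4 / Y ^+ 4 * (A ^+ 2)^-1 =
  (c2 * c1 ^+ 2)^-1 * (h ^+ 2 * (chi (h * P) * ((X / Y) ^+ 2 * (P / A)) ^+ 2)).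
Proof.
move=> h0 P0; rewrite /chi [(c2 * _)^-1]invfM -[(Y ^+ 4)^-1]exprVn.
rewrite -[(A ^+ 2)^-1]exprVn -[(c1 ^+ 2)^-1]exprVn.
move: c1^-1 c2^-1 Y^-1 A^-1 => c1' c2' Y' A'.
by field; rewrite h0 P0.
Qed.

Lemma rhs_shape (L : fieldType) (A c1 c2 X Y h a E : L) :
  (- 2) * ((1 - h) / c1) ^+ 2 * ((1 - E) / c2) * X / ((1 + a) * Y) * (h / A) =
  (c2 * c1 ^+ 2)^-1 * - ((1 - E) * (X / Y) / A * (2 * h * (1 - h) ^+ 2 / (1 + a))).
Proof.
rewrite [(c2 * _)^-1]invfM [((1 + a) * _)^-1]invfM -[(c1 ^+ 2)^-1]exprVn.
move: c1^-1 c2^-1 Y^-1 A^-1 (1 + a)^-1 => c1' c2' Y' A' a'.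
ring.
Qed.

Lemma perturbed_split (L : fieldType) (a S S' u v x : L) : a * S' = u * (v - x) ->
  a * S + u * x = a * (S - S') + u * v.
Proof. by move=> E; rewrite mulrBr E; ring. Qed.

Lemma rhs_regroup (L : fieldType) (u r x y b : L) :
  u * r / x * (y / b) = u * (x^-1 * (y * (r / b))).
Proof. by move: x^-1 b^-1 => x' b'; ring. Qed.

Lemma perturbed_regroup (L : fieldType) (u r x a v b : L) :
  u * r / x * (a * v / b) = u * v * (a * x^-1 * (r / b)).
Proof. by move: x^-1 b^-1 => x' b'; ring. Qed.

Section Shapes.
Variables (n d : nat) (t : int).
Local Notation p := (qq ^+ (2 * d)).
Local Notation h := (qq ^ t).
Local Notation a := (h ^+ 2).
Local Notation c := ((1 - qq ^+ 2) * (1 - qq) ^+ 2)^-1.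

Let aE : qq ^ (2 * t) = a := esym (qq_sqr t).

Definition psi_sum (l : nat) : RF :=
  \sum_(0 <= k < l) chi (h * p ^+ k) * psi_prod a p 0 k ^+ 2.

(** The right-hand side is [- c] times this, so the congruence amounts to the vanishing of
    [a * psi_sum d t l + closed_form d t m]. *)
Definition closed_form (m : nat) : RF :=
  (1 - a * p ^+ m) * (qpoch (a ^+ 2) p m / qpoch p p m) / a ^+ m
  * (2 * h * (1 - h) ^+ 2 / (1 + a)).

Lemma epsE m : n%:Z = t + (d * m)%N%:Z -> a * p ^+ m = qq ^+ (2 * n).
Proof.
move=> nE; rewrite -aE -[p ^+ m]exprM [qq ^+ (2 * d * m)]exprnP -(expfzDr _ _ qq_neq0).
by rewrite [RHS]exprnP; congr (_ ^ _); rewrite -mulnA PoszM -mulrDr -nE -PoszM.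
Qed.

Lemma summandE k :
  qint2 ((2 * d * k)%N%:Z + t) * qint ((2 * d * k)%N%:Z + t) ^+ 2
    * qpoch (qq ^ (2 * t)) p k ^+ 4 / qpoch p p k ^+ 4 * qq ^ (- (4 * t * k%:Z))
  = c * (a * (chi (h * p ^+ k) * psi_prod a p 0 k ^+ 2)).
Proof.
have q0 := qq_neq0.
have h0 : h != 0 := expfz_neq0 t q0.
have p0 : p != 0 := expf_neq0 (2 * d) q0.
have u1 : qq ^ ((2 * d * k)%N%:Z + t) = h * p ^+ k.
  by rewrite [LHS](expfzDr _ _ q0) mulrC -[p ^+ k]exprM.
have u2 : qq ^ (2 * ((2 * d * k)%N%:Z + t)) = (h * p ^+ k) ^+ 2.
  by rewrite -u1 [RHS]exprnP exprz_exp; congr (_ ^ _); ring.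
have u3 : qq ^ (- (4 * t * k%:Z)) = ((a ^+ k) ^+ 2)^-1.
  rewrite -[LHS]invr_expz -aE; congr (_^-1).
  rewrite [RHS]exprnP [X in X ^ 2%N]exprnP !exprz_exp; congr (_ ^ _); ring.
rewrite (psi_prod0_sqr k p0 (expf_neq0 2 h0)) [(p / a) ^+ k]expr_div_n.
rewrite -(summand_shape _ _ _ _ _ h0 (expf_neq0 k p0)).
by rewrite /qint2 /qint u1 u2 u3 aE.
Qed.

Lemma rhsE m : n%:Z = t + (d * m)%N%:Z ->
  (- 2) * qint t ^+ 2 * qint2 n%:Z * qpoch (qq ^ (4 * t)) p m
    / ((1 + qq ^ (2 * t)) * qpoch p p m) * qq ^ (t - 2 * t * m%:Z)
  = c * - closed_form m.
Proof.
move=> nE; have q0 := qq_neq0.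
have u1 : qq ^ (t - 2 * t * m%:Z) = h / a ^+ m.
  rewrite [LHS](expfzDr _ _ q0) -aE; congr (_ * _); rewrite -[LHS]invr_expz; congr (_^-1).
  by rewrite [RHS]exprnP exprz_exp.
have u2 : qq ^ (4 * t) = a ^+ 2.
  by rewrite -aE [RHS]exprnP exprz_exp; congr (_ ^ _); ring.
rewrite -[RHS]rhs_shape u1 u2 aE (epsE nE) /qint /qint2.
by [].
Qed.
End Shapes.

(** * Orders of vanishing at each root, and the congruences *)

Section Local.
Variables (n d m e : nat) (t : int) (z : algC).
Hypotheses (d_gt1 : (1 < d)%N) (co_dn : coprime d n).
Hypotheses (nE : n%:Z = t + (d * m)%N%:Z) (mn : (m < n)%N).
Hypothesis t_ndvd : forall j : int, t != d%:Z * j.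
Hypotheses (z_prim : e.-primitive_root (z ^+ 2)) (e_gt1 : (1 < e)%N) (en : (e %| n)%N).

Local Notation p := (qq ^+ (2 * d)).
Local Notation h := (qq ^ t).
Local Notation a := (h ^+ 2).
Local Notation eps := (a * p ^+ m).
Local Notation S l := (psi_sum d t l).
Local Notation T := (closed_form d t m).

Let d_gt0 : (0 < d)%N. Proof. exact: ltnW. Qed.
Let co_de : coprime d e. Proof. exact: coprime_dvdr en co_dn. Qed.
Let z0 : z != 0 := z_neq0 z_prim e_gt1.

Lemma az_pz : (z ^ t) ^+ 2 * (z ^+ (2 * d)) ^+ m = 1.
Proof.
rewrite -exprM [(z ^ t) ^+ 2]exprnP exprz_exp exprnP -expfzDr //.
have -> : t * 2%N + (2 * d * m)%N%:Z = (2 * n)%N%:Z by lia.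
have [j ->] := dvdnP en.
by rewrite -exprnP [(j * e)%N]mulnC exprM [_ ^+ (e * j)]exprM (prim_expr_order z_prim) expr1n.
Qed.

Let t0 : t != 0. Proof. by have := t_ndvd 0; rewrite mulr0. Qed.

Let regular_am : regular z (a ^+ m)^-1.
Proof.
eexists; apply: evV; first by apply: evX; apply: evX; exact: ev_qz.
by rewrite !expf_neq0 // expfz_neq0.
Qed.

Let regular_h : regular z h. Proof. exact: regular_qz. Qed.

Let vanish_eps : vanish z 1 (1 - eps).
Proof.
apply: ev0_vanish; rewrite -(subrr 1); apply: ev1B.
have ev_eps1 := ev_eps z_prim e_gt1 az_pz; exact: ev_eps1.
Qed.

Lemma T_vanish : vanish z 1 T.
Proof.
rewrite /closed_form rhs_regroup; apply: vanishMr => //; apply: regularM => //; apply: regularM.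
  apply: regularM; last by apply: regularX; apply: regularB => //; exact: regular1.
  apply: regularM => //; apply: regularD; exact: regular1.
exact: (regular_rhs_factor z_prim e_gt1 co_de d_gt0 az_pz t0).
Qed.

Lemma full_vanish : e = n -> vanish z 3 (a * S m.+1 + T).
Proof.
move=> eE; have me : (m < e)%N by rewrite eE.
have p0 : p != 0 by rewrite expf_neq0 ?qq_neq0.
have h0 : h != 0 by rewrite expfz_neq0 ?qq_neq0.
have pq i : p ^+ i = qq ^ (2 * d * i)%N%:Z by rewrite -exprM.
have aq := qq_sqr t.
have key := @perturbed_chi_sum _ h p m p0 h0.
(* The closed form needs nonzero denominators. In [c2] and [c3] a zero exponent of q would make [t]
   a multiple of [d]. *)
have c1 i : 1 - p ^+ i.+1 != 0 by rewrite (pq i.+1); apply: qq_exprz_neq1; lia.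
have c2 i : 1 - a * p ^+ i != 0.
  have -> : a * p ^+ i = qq ^ (2 * t + (2 * d * i)%N%:Z).
    by rewrite (expfzDr _ _ qq_neq0) -(pq i) -aq.
  by apply: qq_exprz_neq1; have := t_ndvd (- i%:Z); lia.
have c3 i : 1 - p ^+ i / eps != 0.
  have -> : p ^+ i / eps = qq ^ ((2 * d * i)%N%:Z + - (2 * n)%N%:Z).
    by rewrite (expfzDr _ _ qq_neq0) -(pq i) (epsE nE) exprnN.
  by apply: qq_exprz_neq1; have := t_ndvd (i%:Z - m%:Z); lia.
have {key} := key c1 c2 c3 (qq_sqr_add1_neq0 t0).
rewrite prodf_div [\prod_(i < m) (1 - p ^+ i.+1)](_ : _ = qpoch p p m); last first.
  by apply: eq_bigr => i _; rewrite exprS.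
(* What remains is the perturbation error and a regular multiple of [(1 - eps) * psi eps], each of
   order 3. *)
rewrite /closed_form => /perturbed_split ->; apply: vanishD.
  apply: vanishMl; first exact: regularX.
  exact: (perturbation_vanish z_prim e_gt1 co_de d_gt0 az_pz me).
rewrite perturbed_regroup; apply: vanishMr.
  by apply: (@vanishM _ 1 2) => //; exact: (vanish_w z_prim e_gt1 az_pz).
apply: regularM; first by apply: regularM => //; exact: regularX.
exact: (regular_rhs_factor z_prim e_gt1 co_de d_gt0 az_pz t0).
Qed.

Lemma local_truncated : vanish z (if e == n then 3 else 1) (a * S m.+1 + T).
Proof.
case: eqP => [/full_vanish//|_]; apply: vanishD; last exact: T_vanish.
apply: vanishMl; first exact: regularX.
exact: (truncated_sum_vanish z_prim e_gt1 co_de d_gt0 az_pz).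
Qed.

(** For [e = n] the additional terms have order 3 one by one; otherwise [n] is a multiple of [e] and
    the sum consists of complete blocks. *)
Lemma local_full : vanish z (if e == n then 3 else 1) (a * S n + T).
Proof.
have := local_truncated; case: eqP => [eE|_] tr.
  rewrite /psi_sum (big_cat_nat (n := m.+1)) //= mulrDr addrAC; apply: vanishD => //.
  apply: vanishMl; first exact: regularX.
  rewrite big_seq_cond; apply: vanish_sum => k; rewrite mem_index_iota andbT => /andP[mk kn].
  by apply: (tail_vanish z_prim e_gt1 co_de d_gt0 az_pz); rewrite eE ?mk.
apply: vanishD; last exact: T_vanish.
apply: vanishMl; first exact: regularX.
have [r nr] := dvdnP en; rewrite nr.
exact: (blocks_vanish z_prim e_gt1 co_de d_gt0 az_pz).
Qed.
End Local.

Theorem theorem6 (n d : nat) (t : int) :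
  (1 < n)%N -> (2 <= d)%N ->
  coprimez t d%:Z ->
  (n%:Z = t %[mod d%:Z])%Z ->
  n%:Z + d%:Z - n%:Z * d%:Z <= t -> t <= n%:Z ->
  let m : nat := `|((n%:Z - t) %/ d%:Z)%Z|%N in
  let P : {poly rat} := qint2_poly n * PhiQ2 n ^+ 2 in
  let term (k : nat) : RF :=
    qint2 ((2 * d * k)%N%:Z + t) * qint ((2 * d * k)%N%:Z + t) ^+ 2
    * qpoch (qq ^ (2 * t)) (qq ^+ (2 * d)) k ^+ 4
    / qpoch (qq ^+ (2 * d)) (qq ^+ (2 * d)) k ^+ 4
    * qq ^ (- (4 * t * k%:Z)) in
  let rhs : RF :=
    (- 2) * qint t ^+ 2 * qint2 n%:Z * qpoch (qq ^ (4 * t)) (qq ^+ (2 * d)) m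
    / ((1 + qq ^ (2 * t)) * qpoch (qq ^+ (2 * d)) (qq ^+ (2 * d)) m)
    * qq ^ (t - 2 * t * m%:Z) in
  cong_mod (\sum_(0 <= k < m.+1) term k) rhs P /\
  cong_mod (\sum_(0 <= k < n) term k) rhs P.
Proof.
move=> n1 d1 co_td n_t t_ge t_le m P term rhs.
have d0 : d%:Z != 0 by lia.
have mE : m%:Z * d%:Z = n%:Z - t.
  have dv : (d%:Z %| n%:Z - t)%Z by rewrite -eqz_mod_dvd; apply/eqP.
  rewrite /m abszE ger0_norm ?divzK // divz_ge0; lia.
have nE : n%:Z = t + (d * m)%N%:Z by lia.
(* The lower bound on [t] says that [m * d] is at most [(n - 1) * d]. *)
have mn : (m < n)%N by nia.
have co_dn : coprime d n.
  have : coprimez d%:Z n%:Z by rewrite nE PoszM mulrC addrC /coprimez gcdzMDl gcdzC.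
  by rewrite coprimezE.
have t_nd (j : int) : t != d%:Z * j.
  apply/eqP => tj; move: co_td; rewrite tj coprimezMl => /andP[].
  by rewrite coprimezE /= /coprime gcdnn; lia.
have rhsE' : rhs = _ := rhsE nE.
(* A square root of a primitive [n]-th root of unity is a root of [P]. *)
have sz : (1 < size P)%N.
  have [x xn] := C_prim_root_exists (ltnW n1).
  have X0 : 'X ^+ (2 * n) - 1 != 0 :> {poly algC}.
    by rewrite monic_neq0 // monicXnsubC //; lia.
  rewrite -(size_map_poly (ratr : {rmorphism rat -> algC})).
  apply: (@root_size_gt1 _ (sqrtC x)).
    rewrite /P rmorphM rmorphXn mulf_neq0 ?expf_neq0 //.
      by apply: dvdpN0 X0; rewrite -Cpoly_qint2 dvdp_mulr.
    by apply: dvdpN0 X0; apply: Cpoly_PhiQ2_dvd; exact: ltnW.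
  rewrite /P rmorphM rmorphXn rootM; apply/orP; right.
  by rewrite /= expr2 rootM orbb root_PhiQ2 ?sqrtCK // ltnW.
have final l : (forall z e, e.-primitive_root (z ^+ 2) -> (1 < e)%N -> (e %| n)%N ->
    vanish z (if e == n then 3 else 1) ((qq ^ t) ^+ 2 * psi_sum d t l + closed_form d t m)) ->
  cong_mod (\sum_(0 <= k < l) term k) rhs P.
  move=> van; apply: cong_mod_vanish => // z k k0 zk.
  have [e [ze e1 en ke]] := modulus_multiplicity n1 k0 zk.
  apply: vanish_leq ke _.
  rewrite (eq_bigr _ (fun k _ => summandE d t k)) rhsE' -!mulr_sumr -mulrBr opprK.
  apply: vanishMl; last exact: van ze e1 en.
  (* The constant prefactor is regular at [z]: as [e > 1], neither [z ^+ 2] nor [z] equals 1. *)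
  have nz : 1 - z ^+ 2 != 0.
    rewrite subr_eq0 eq_sym -[z ^+ 2]expr1 -(prim_order_dvd ze) dvdn1; lia.
  eexists; apply: evV; first apply: evM.
  - apply: ev1B; exact: evX (ev_q z).
  - apply: evX; apply: ev1B; exact: ev_q.
  - rewrite mulf_neq0 // expf_neq0 //; apply: contraNneq nz => z1.
    by rewrite -[1 in X in X == _](expr1n _ 2) subr_sqr z1 mul0r.
split; apply: final => z e ze e1 en.
  exact: local_truncated d1 co_dn nE mn t_nd ze e1 en.
exact: local_full d1 co_dn nE mn t_nd ze e1 en.
Qed.
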